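(* Let $\mathbb{P}$ be a multiplicative subsemigroup of $\mathbb{N}=\{1,2,3,\dots\}$ with $\mathbb{P}\not\subseteq\{1\}$, and let $\mathbf{C}_{\mathbb{P}}$ be the class of all $\mathbb{P}$-torsion-free cones. Let $M$ be $\mathbf{C}_{\mathbb{P}}$-strongly unitarily closed. Then $M$ is a quasi-divisible refinement cone.
   Context: Commutative monoids are written additively. The algebraic preordering of a commutative monoid $M$ is $x\le y\iff(\exists z\in M)(x+z=y)$. A cone is a commutative monoid that is conical: $x+y=0\Rightarrow x=y=0$. A commutative monoid is $\mathbb{P}$-torsion-free if for all $p\in\mathbb{P}$, $px=py\Rightarrow x=y$. It is quasi-divisible if for every $x$ there are $u,v$ with $2u+3v=x$. A refinement cone is a cone with the refinement property: whenever $a_0+a_1=b_0+b_1$ there are $c_{ij}$ ($i,j<2$) with $a_i=c_{i0}+c_{i1}$ and $b_i=c_{0i}+c_{1i}$ for all $i<2$. If $A$ is a submonoid of a commutative monoid $B$, then $B$ is a strong unitary extension of $A$ if: $A$ is cofinal in $B$ (every $b\in B$ satisfies $b\le a$ in $B$ for some $a\in A$); for all $a_0,a_1\in A$ and $b\in B$, $a_0+b=a_1$ implies $b\in A$; and for all $m\in\mathbb{N}$ and $b\in B$, $mb\in A$ implies $b\in A$. An equation system with parameters from $M$ is a finite set of equations, each of the form $\sum_{i<k}p_i\mathbf{x}_i+a=\sum_{i<k}q_i\mathbf{x}_i+b$ with $k,p_i,q_i$ non-negative integers, $a,b\in M$, and $\mathbf{x}_i$ unknowns. An element $M$ of $\mathbf{C}_{\mathbb{P}}$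 is $\mathbf{C}_{\mathbb{P}}$-strongly unitarily closed if every equation system with parameters from $M$ that has a solution in some strong unitary extension of $M$ belonging to $\mathbf{C}_{\mathbb{P}}$ has a solution in $M$. *)

(* Defs.v *)
From HB Require Import structures.
From mathcomp Require Import all_boot all_algebra.
From mathcomp Require Import classical_sets functions cardinality.

Set Implicit Arguments.
Unset Strict Implicit.
Unset Printing Implicit Defensive.

Import GRing.Theory.
Local Open Scope ring_scope.
Local Open Scope classical_set_scope.

Definition alg_le (M : nmodType) (x y : M) : Prop := exists z, x + z = y.

Definition conical (M : nmodType) : Prop :=
  forall x y : M, x + y = 0 -> x = 0 /\ y = 0.

Definition torsion_free (P : set nat) (M : nmodType) : Prop :=
  forall p, P p -> forall x y : M, x *+ p = y *+ p -> x = y.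

Definition quasi_divisible (M : nmodType) : Prop :=
  forall x : M, exists u v : M, u *+ 2 + v *+ 3 = x.

Definition refinement (M : nmodType) : Prop :=
  forall a0 a1 b0 b1 : M, a0 + a1 = b0 + b1 ->
  exists c00 c01 c10 c11 : M,
    [/\ a0 = c00 + c01, a1 = c10 + c11, b0 = c00 + c10 & b1 = c01 + c11].

Definition refinement_cone (M : nmodType) : Prop := conical M /\ refinement M.

Definition torsion_free_cone (P : set nat) (M : nmodType) : Prop :=
  conical M /\ torsion_free P M.

Definition submonoid (B : nmodType) (A : set B) : Prop :=
  A 0 /\ forall x y, A x -> A y -> A (x + y).

Definition strong_unitary_extension (B : nmodType) (A : set B) : Prop :=
  [/\ submonoid A,
      forall b, exists2 a, A a & alg_le b a,
      forall a0 a1 b, A a0 -> A a1 -> a0 + b = a1 -> A b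
    & forall m b, (0 < m)%N -> A (b *+ m) -> A b].

(* The equation \sum_(i < k) p i x_i + a = \sum_(i < k) q i x_i + b.  All
   equations of a system draw on the same unknowns x_0, x_1, ..., so an
   assignment is a map nat -> M. *)
Record equation (M : nmodType) := Equation {
  eq_k : nat;
  eq_p : 'I_eq_k -> nat;
  eq_q : 'I_eq_k -> nat;
  eq_a : M;
  eq_b : M }.

Definition satisfies (M : nmodType) (x : nat -> M) (E : equation M) : Prop :=
  \sum_(i < eq_k E) x i *+ eq_p i + eq_a E =
  \sum_(i < eq_k E) x i *+ eq_q i + eq_b E.

Definition solvable (M : nmodType) (S : set (equation M)) : Prop :=
  exists x : nat -> M, forall E, S E -> satisfies x E.

Definition map_equation (M B : nmodType) (e : M -> B) (E : equation M) :
    equation B :=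
  Equation (@eq_p M E) (@eq_q M E) (e (eq_a E)) (e (eq_b E)).

(* An extension B of M is presented as an injective morphism e : M -> B, M being
   identified with the submonoid range e of B. *)
Definition strongly_unitarily_closed (C : nmodType -> Prop) (M : nmodType) :
    Prop :=
  C M /\
  forall S : set (equation M), finite_set S ->
    (exists (B : nmodType) (e : {additive M -> B}),
      [/\ C B, injective e, strong_unitary_extension (range e)
        & solvable (map_equation e @` S)]) ->
    solvable S.

Definition subsemigroup_of_positives (P : set nat) : Prop :=
  (forall p, P p -> (0 < p)%N) /\ (forall p q, P p -> P q -> P (p * q)%N).

(* Main.v *)
(* Given a system over M, let B be the monoid obtained from M by freely adjoining
   the unknowns, subject to the system, in the class of P-torsion-free
   commutative monoids.
   - B contains M provided the elements of M are separated by morphisms into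
     P-torsion-free monoids in which the system is solvable.  Since M is
     separative, its elements are separated by morphisms into monoids of the form
     "abelian group with an infinity", where every refinement problem and every
     equation 2u + 3v = x is solvable.
   - B is conical because, when neither side of an equation is zero, sending
     every nonzero element and every unknown to the nonzero element of the
     two-element semilattice is compatible with the system.
   - Give the unknowns integer degrees making the system homogeneous of degree 0
     over M, namely (3, -2) for 2u + 3v = x and (1, -1, -1, 1) for the c_ij of a
     refinement.  Then M is exactly the set of elements of degree 0, so B is a
     strong unitary extension of M. *)

Require Import Defs.
From HB Require Import structures.
From mathcomp Require Import all_boot all_algebra.
From mathcomp Require Import classical_sets functions cardinality.
From mathcomp Require Import boolp zify.
From mathcomp Require Import generic_quotient.

Set Implicit Arguments.
Unset Strict Implicit.
Unset Printing Implicit Defensive.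

Import GRing.Theory.
Local Open Scope ring_scope.
Local Open Scope classical_set_scope.

(** * Quotients of commutative monoids by congruences *)

Definition additive_of (U V : nmodType) (f : U -> V) (f_morph : nmod_morphism f) :
  {additive U -> V} := HB.pack f (GRing.isNmodMorphism.Build U V f f_morph).

Lemma nmod_quotient (T : nmodType) (R : T -> T -> Prop) :
    (forall x, R x x) -> (forall x y, R x y -> R y x) ->
    (forall x y z, R x y -> R y z -> R x z) ->
    (forall x y z, R x y -> R (x + z) (y + z)) ->
  exists (Q : nmodType) (pi : {additive T -> Q}),
    (forall q, exists t, pi t = q) /\ (forall x y, pi x = pi y <-> R x y).
Proof.
move=> Rrefl Rsym Rtrans Radd.
have e_refl : reflexive (fun x y => `[< R x y >]) by move=> x; apply/asboolP.
have e_sym : symmetric (fun x y => `[< R x y >]).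
  by move=> x y; apply: asbool_equiv_eq; split; apply: Rsym.
have e_trans : transitive (fun x y => `[< R x y >]).
  by move=> y x z /asboolP Rxy /asboolP Ryz; apply/asboolP; apply: Rtrans Ryz.
pose e := EquivRel (fun x y => `[< R x y >]) e_refl e_sym e_trans.
pose Q0 : choiceType := {eq_quot e}%qT.
pose pi (x : T) : Q0 := (\pi_({eq_quot e}%qT) x)%qT.
have piE x y : pi x = pi y <-> R x y.
  by split=> [/eqmodP/asboolP|Rxy] //; apply/eqmodP/asboolP.
pose rp (q : Q0) : T := repr (q : {eq_quot e}%qT).
have rpK q : pi (rp q) = q by exact: reprK.
pose add q q' := pi (rp q + rp q').
have addE x y : add (pi x) (pi y) = pi (x + y).
  apply/piE/(Rtrans _ (x + rp (pi y))); first exact/Radd/piE/rpK.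
  by rewrite ![x + _]addrC; apply/Radd/piE/rpK.
have addA : associative add.
  by move=> p q r; rewrite -(rpK p) -(rpK q) -(rpK r) !addE addrA.
have addC : commutative add by move=> p q; rewrite /add addrC.
have add0 : left_id (pi 0) add by move=> q; rewrite -(rpK q) addE add0r.
pose Q : nmodType := HB.pack Q0 (GRing.isNmodule.Build Q0 addA addC add0).
have pi_nmod : nmod_morphism (pi : T -> Q) by split=> // x y; rewrite -addE.
by exists Q, (additive_of pi_nmod); split=> // q; exists (rp q).
Qed.

(** * The algebraic preordering and faces *)

Lemma alg_le_add (M : nmodType) (x y x' y' : M) :
  alg_le x y -> alg_le x' y' -> alg_le (x + x') (y + y').
Proof. by move=> [z <-] [z' <-]; exists (z + z'); rewrite addrACA. Qed.

Lemma alg_le_trans (M : nmodType) (y x z : M) :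
  alg_le x y -> alg_le y z -> alg_le x z.
Proof. by move=> [u <-] [v <-]; exists (u + v); rewrite addrA. Qed.

Lemma alg_le_addr (M : nmodType) (x y : M) : alg_le x (x + y).
Proof. by exists y. Qed.

Lemma alg_le_mulrn (M : nmodType) (x y : M) n :
  alg_le x y -> alg_le (x *+ n) (y *+ n).
Proof. by move=> [z <-]; exists (z *+ n); rewrite mulrnDl. Qed.

Lemma alg_le_mulrnr (M : nmodType) (x : M) m n :
  (m <= n)%N -> alg_le (x *+ m) (x *+ n).
Proof. by move=> /subnKC <-; rewrite mulrnDr; apply: alg_le_addr. Qed.

Lemma cancel_alg_le (M : nmodType) (x y z w : M) :
  alg_le z w -> x + z = y + z -> x + w = y + w.
Proof. by move=> [u <-] xz_yz; rewrite !addrA xz_yz. Qed.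

Definition face (M : nmodType) (e z : M) : Prop := exists n, alg_le z (e *+ n).

Lemma face_add (M : nmodType) (e x y : M) :
  face e (x + y) <-> face e x /\ face e y.
Proof.
split=> [[n xy_le]|[[m x_le] [n y_le]]]; last first.
  by exists (m + n)%N; rewrite mulrnDr; apply: alg_le_add.
split; exists n; apply: alg_le_trans xy_le; first exact: alg_le_addr.
by rewrite addrC; apply: alg_le_addr.
Qed.

Lemma face_mulrn (M : nmodType) (e x : M) n :
  (0 < n)%N -> face e (x *+ n) <-> face e x.
Proof.
elim: n => // -[|n] IH _; first by rewrite mulr1n.
by rewrite mulrS face_add IH //; split=> [[]|].
Qed.

(** * Groups with infinity, and the two-element semilattice *)

(** By the first two clauses there is at most one element outside [fin], and it absorbs every sum;
    plain abelian groups are included. *)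
Definition group_with_infinity (N : nmodType) : Prop :=
  exists fin : N -> Prop,
    [/\ forall a b, fin (a + b) <-> fin a /\ fin b,
        forall a b, ~ fin a -> ~ fin b -> a = b
      & forall a, fin a -> exists b, a + b = 0].

Lemma group_with_infinity_refinement (N : nmodType) :
  group_with_infinity N -> refinement N.
Proof.
move=> [fin [finD fin_inf fin_opp]] a0 a1 b0 b1 eq_ab.
have [fin_s|inf_s] := pselect (fin (a0 + a1)).
  have [n b0n] : exists n, b0 + n = 0.
    by apply: fin_opp; move: fin_s; rewrite eq_ab finD => -[].
  (* With [n] the inverse of [b0], the corner [c00] can be 0 and the other entries follow by
     subtraction. *)
  exists 0, a0, b0, (a1 + n); split; rewrite ?add0r //.
    by rewrite addrCA b0n addr0.
  by rewrite addrA eq_ab addrAC b0n add0r.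
have inf_a : ~ fin a0 \/ ~ fin a1 by apply/not_andP; rewrite -finD.
have inf_b : ~ fin b0 \/ ~ fin b1 by apply/not_andP; rewrite -finD -eq_ab.
have inf_add a b c : ~ fin a -> ~ fin b -> a = b + c.
  by move=> inf_a' inf_b'; apply: fin_inf => //; rewrite finD => -[].
have inf_addr a b c : ~ fin a -> ~ fin b -> a = c + b.
  by rewrite addrC; apply: inf_add.
(* If [a_i] and [b_j] are infinite, put [a_i] at [c_ij], the other [b] beside it in its row, the
   other [a] in its column, and 0 in the opposite corner. *)
case: inf_a => inf_a; case: inf_b => inf_b.
- by exists a0, b1, a1, 0; rewrite ?addr0 ?add0r; split; auto.
- by exists b0, a0, 0, a1; rewrite ?addr0 ?add0r; split; auto.
- by exists a0, 0, a1, b1; rewrite ?addr0 ?add0r; split; auto.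
- by exists 0, a0, b0, a1; rewrite ?addr0 ?add0r; split; auto.
Qed.

Lemma group_with_infinity_quasi_divisible (N : nmodType) :
  group_with_infinity N -> quasi_divisible N.
Proof.
move=> [fin [finD fin_inf fin_opp]] x.
have [fin_x|inf_x] := pselect (fin x).
  (* A finite [x] is 2(-x) + 3x; below, an infinite [x] equals 5x. *)
  have [y xy0] := fin_opp x fin_x; exists y, x.
  by rewrite (mulrS x 2) addrCA -mulrnDl [y + x]addrC xy0 mul0rn addr0.
exists x, x; rewrite -mulrnDr; apply: fin_inf => //.
by rewrite mulrS finD => -[].
Qed.

(* The semilattice {0, infinity}, which is not the additive group of the field
   bool. *)
Definition or_bool := bool.
HB.instance Definition _ := Choice.on or_bool.
HB.instance Definition _ := GRing.isNmodule.Build or_bool orbA orbC orFb.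

(** * Separativity, and separation of elements by groups with infinity *)

Section TorsionFree.

Variables (P : set nat) (P_semigroup : subsemigroup_of_positives P).
Variables (p0 : nat) (P_p0 : P p0) (p0_gt1 : (1 < p0)%N).

(* The hypotheses make x and y interchangeable in any sum with at least n copies
   of x or at least n copies of y, hence q x = q y for all q >= 2n. *)
Lemma torsion_free_separative (M : nmodType) (x y : M) n :
  torsion_free P M -> x + x *+ n = y + x *+ n -> x + y *+ n = y + y *+ n -> x = y.
Proof.
move=> M_tf xn yn.
have x_step m : x *+ m + x *+ n = y *+ m + x *+ n.
  by elim: m => // m IH; rewrite !mulrS -!addrA IH (addrCA x) xn addrCA.
have y_step m : x *+ m + y *+ n = y *+ m + y *+ n.
  by elim: m => // m IH; rewrite !mulrS -!addrA IH (addrCA x) yn addrCA.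
have [P_pos PM] := P_semigroup.
(* [P] is unbounded, since multiplying by [p0] strictly increases its elements. *)
have [q P_q q_ge] : exists2 q, P q & (n + n <= q)%N.
  elim: (n + n)%N => [|m [q Pq lt_q]]; first by exists p0.
  exists (p0 * q)%N; first exact: PM.
  by have := P_pos _ Pq; nia.
apply: (M_tf q) => //; rewrite -(subnKC q_ge) !mulrnDr.
rewrite x_step -y_step -!addrA [x *+ n + _]addrC x_step [RHS]addrCA.
by congr (_ + _); rewrite addrC.
Qed.

(** As [x] lies below a multiple of [y], the summand [x *+ n] lies below multiples of both [x *+ p]
    and [y *+ p]. Enlarging it to these gives the two hypotheses of [torsion_free_separative] for
    [x *+ p] and [y *+ p]. *)
Lemma torsion_free_cancel (M : nmodType) (x y : M) n p :
  torsion_free P M -> P p -> face x y -> face y x ->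
  x *+ p + x *+ n = y *+ p + x *+ n -> x = y.
Proof.
move=> M_tf P_p [k x_k] [l x_l] eq_xy; apply: (M_tf p) => //.
have p_gt0 : (0 < p)%N by case: P_semigroup => + _; apply.
apply: (@torsion_free_separative _ _ _ (n + n * l)) => //.
  apply: cancel_alg_le eq_xy; rewrite -mulrnA; apply: alg_le_mulrnr; nia.
apply: cancel_alg_le eq_xy; rewrite -mulrnA.
apply: (alg_le_trans (alg_le_mulrn n x_l)).
by rewrite -mulrnA; apply: alg_le_mulrnr; nia.
Qed.

(* The quotient of M * M in which (a, b) stands for the difference a - b when a
   and b lie in the face generated by e, and for infinity otherwise. *)
Lemma localization (M : nmodType) (e : M) : torsion_free P M ->
  exists (N : nmodType) (g : {additive M -> N}),
    [/\ torsion_free P N, group_with_infinity N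
      & forall x y, g x = g y -> face e x ->
        face e y /\ exists n p, P p /\ x *+ p + e *+ n = y *+ p + e *+ n].
Proof.
move=> M_tf; have [P_pos PM] := P_semigroup.
pose fin (s : M * M) := face e (s.1 + s.2).
have finD s t : fin (s + t) <-> fin s /\ fin t.
  by rewrite /fin /= addrACA face_add.
(* Adding a multiple of [e] builds in cancellation of the whole face, as each of its elements lies
   below such a multiple; the factor [p] makes the quotient [P]-torsion-free. *)
pose eqd (s t : M * M) := exists n p,
  P p /\ (s.1 + t.2) *+ p + e *+ n = (t.1 + s.2) *+ p + e *+ n.
pose R s t := (~ fin s /\ ~ fin t) \/ [/\ fin s, fin t & eqd s t].
have Rrefl s : R s s.
  have [fin_s|] := pselect (fin s); last by left.
  by right; split=> //; exists 0%N, p0.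
have Rsym s t : R s t -> R t s.
  case=> [[]|[fs ft [n [p [Pp st]]]]]; first by left.
  by right; split=> //; exists n, p.
have Rtrans s t u : R s t -> R t u -> R s u.
  move=> [[fs ft]|[fs ft [n [p [Pp st]]]]] [[ft' fu]|[ft' fu [m [q [Pq tu]]]]] //.
    by left.
  right; split=> //.
  (* In the sum of the two scaled equations the middle pair [t] occurs on both sides; [w] completes
     it to [e *+ k], which joins the multiple of [e]. *)
  have [k [w tk]] : face e ((t.1 + t.2) *+ (p * q)).
    by apply/face_mulrn => //; have := P_pos _ Pp; have := P_pos _ Pq; nia.
  exists (k + n * q + m * p)%N, (p * q)%N; split; first exact: PM.
  have := f_equal (+%R w) (f_equal2 +%R (f_equal (fun z => z *+ q) st)
                                        (f_equal (fun z => z *+ p) tu)).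
  rewrite !mulrnDl -!mulrnA ![(q * p)%N]mulnC !mulrnDr -tk !mulrnDl !addrA => stu.
  rewrite [LHS](ACl (5*1*4*6*3*2*7)) [RHS](ACl (5*3*2*6*1*4*7)) /=.
  exact: stu.
have Radd s t u : R s t -> R (s + u) (t + u).
  have [fu|fu] := pselect (fin u); last by left; rewrite !finD; tauto.
  case=> [[fs ft]|[fs ft [n [p [Pp st]]]]]; first by left; rewrite !finD; tauto.
  right; split; try exact/finD; exists n, p; split=> //=.
  by rewrite !(addrACA _ u.1) !(mulrnDl p (_ + _)) addrAC st addrAC [u.1 + _]addrC.
have [N [pi [pi_surj piE]]] := nmod_quotient Rrefl Rsym Rtrans Radd.
pose g (x : M) := pi (x, 0).
have g_morph : nmod_morphism g.
  split=> [|x y]; first exact: raddf0.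
  by rewrite /g -raddfD; congr (pi (_, _)); rewrite addr0.
exists N, (additive_of g_morph); split.
- move=> q Pq x y; have [s <-] := pi_surj x; have [t <-] := pi_surj y.
  have q_gt0 := P_pos _ Pq.
  have mulE (u : M * M) : u *+ q = (u.1 *+ q, u.2 *+ q).
    by rewrite [LHS]surjective_pairing (raddfMn fst) (raddfMn snd).
  have fin_q u : fin (u *+ q) <-> fin u.
    by rewrite mulE /fin /= -mulrnDl face_mulrn.
  rewrite -!raddfMn => /piE [[fs ft]|[/fin_q fs /fin_q ft [n [p [Pp st]]]]].
    by apply/piE; left; split=> /fin_q.
  apply/piE; right; split=> //; exists n, (q * p)%N; split; first exact: PM.
  by move: st; rewrite !mulE /= -!mulrnDl -!mulrnA.
- exists (fun x => exists2 s, pi s = x & fin s); split.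
  + move=> x y; have [s <-] := pi_surj x; have [t <-] := pi_surj y.
    have finE u : (exists2 v, pi v = pi u & fin v) <-> fin u.
      by split=> [[v /piE [[]|[]]]|] //; exists u.
    by rewrite -raddfD !finE.
  + move=> x y; have [s <-] := pi_surj x; have [t <-] := pi_surj y => fs ft.
    by apply/piE; left; split=> ?; [apply: fs; exists s|apply: ft; exists t].
  + move=> _ [s <- fs]; exists (pi (s.2, s.1)); rewrite -raddfD -(raddf0 pi).
    apply/piE; right; split.
    * by rewrite finD /fin /= [s.2 + _]addrC.
    * by exists 0%N, 0; rewrite /= !addr0 mulr0n.
    * exists 0%N, p0; split=> //; congr (_ *+ _ + _).
      by rewrite /= add0r addr0 addrC.
- move=> x y /piE [[]|[]]; rewrite /fin /= !addr0 // => fx fy [n [p]].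
  by rewrite /= !addr0 => xy _; split=> //; exists n, p.
Qed.

(** If no such morphism separated [x] from [y], the localizations at [x] and at [y] would put each
    in the face of the other, and the one at [x] would give an equation from which
    [torsion_free_cancel] yields [x = y]. *)
Lemma separation (M : nmodType) (x y : M) : torsion_free P M -> x <> y ->
  exists (N : nmodType) (g : {additive M -> N}),
    [/\ torsion_free P N, refinement N, quasi_divisible N & g x <> g y].
Proof.
move=> M_tf neq_xy; apply: contrapT => no_sep; apply: neq_xy.
have same (N : nmodType) (g : {additive M -> N}) :
    torsion_free P N -> group_with_infinity N -> g x = g y.
  move=> N_tf N_gi; apply: contrapT => g_sep; apply: no_sep; exists N, g; split=> //.
    exact: group_with_infinity_refinement.
  exact: group_with_infinity_quasi_divisible.
have face_refl (e : M) : face e e by exists 1%N; rewrite mulr1n; exists 0; rewrite addr0.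
have [N [g [N_tf N_gi g_sep]]] := localization x M_tf.
have [x_y [n [p [Pp xy]]]] := g_sep _ _ (same _ _ N_tf N_gi) (face_refl x).
have [N' [g' [N'_tf N'_gi g'_sep]]] := localization y M_tf.
have [y_x _] := g'_sep _ _ (esym (same _ _ N'_tf N'_gi)) (face_refl y).
exact: torsion_free_cancel xy.
Qed.

(** * Systems of equations and the extension they generate *)

Section Systems.

Variables (M : nmodType) (k : nat).

(** The monoid obtained from [M] by freely adjoining [k] unknowns: a parameter together with the
    multiplicities of the unknowns. *)
Local Notation linform := (M * {ffun 'I_k -> nat})%type.

Definition eval (N : nmodType) (g : M -> N) (c : 'I_k -> N)
    (t : linform) : N :=
  g t.1 + \sum_i c i *+ t.2 i.

Lemma eval_is_nmod_morphism (N : nmodType) (g : {additive M -> N}) c :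
  nmod_morphism (eval g c).
Proof.
split=> [|s t]; rewrite /eval /=.
  by rewrite raddf0 add0r big1 // => i _; rewrite ffunE mulr0n.
rewrite raddfD addrACA -big_split; congr (_ + _).
by apply: eq_bigr => i _; rewrite ffunE mulrnDr.
Qed.

Definition unknown (i : 'I_k) : linform :=
  (0, [ffun j => (i == j) : nat]).

(** Parameters and unknowns generate the free extension. Applied to a quotient map, this shows that
    the classes of the unknowns solve the system in the quotient. *)
Lemma morphism_eval (N : nmodType)
    (f : {additive linform -> N}) t :
  f t = eval (fun x => f (x, 0)) (f \o unknown) t.
Proof.
rewrite /eval /=; under eq_bigr do rewrite -raddfMn.
rewrite -raddf_sum -raddfD; congr (f _).
rewrite [LHS]surjective_pairing [RHS]surjective_pairing /=.
rewrite (raddf_sum fst) (raddf_sum snd) /= big1 ?addr0 => [|i _]; last first.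
  by rewrite (raddfMn fst) mul0rn.
rewrite add0r; congr (_, _); apply/ffunP=> j.
rewrite sum_ffunE (bigD1 j) //= big1 => [|i ij].
  by rewrite (raddfMn snd) ffunMnE ffunE eqxx addr0 natn.
by rewrite (raddfMn snd) ffunMnE ffunE (negbTE ij) mul0rn.
Qed.

Variable r : seq (linform * linform).

Definition solution (N : nmodType) (g : M -> N) (c : 'I_k -> N) : Prop :=
  forall s, s \in r -> eval g c s.1 = eval g c s.2.

(** The congruence defining B, given semantically as an intersection of kernels: compatibility with
    addition and torsion-freeness of the quotient are then inherited from the targets [N]. *)
Definition entails (s t : linform) : Prop :=
  forall (N : nmodType) (g : {additive M -> N}) (c : 'I_k -> N),
    torsion_free P N -> solution g c -> eval g c s = eval g c t.

Definition degree (d : 'I_k -> int) (v : {ffun 'I_k -> nat}) : int :=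
  \sum_i d i *+ v i.

Lemma degree_is_nmod_morphism d : nmod_morphism (degree d).
Proof.
split=> [|u v]; first by apply: big1 => i _; rewrite ffunE mulr0n.
by rewrite /degree -big_split; apply: eq_bigr => i _; rewrite ffunE mulrnDr.
Qed.

Lemma torsion_free_int : torsion_free P int.
Proof. by move=> p /P_semigroup.1 p_gt0 x y; apply: Num.Theory.pmulrnI. Qed.

Lemma torsion_free_or_bool : torsion_free P or_bool.
Proof.
have mulE (b : or_bool) n : (0 < n)%N -> b *+ n = b.
  by elim: n => // -[|n] IH _; rewrite // mulrS IH //; apply: orbb.
by move=> p /P_semigroup.1 p_gt0 x y; rewrite !mulE.
Qed.

Lemma nonzero_is_nmod_morphism : conical M ->
  nmod_morphism (fun x : M => (x != 0) : or_bool).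
Proof.
move=> M_con; split=> [|x y]; first by rewrite eqxx.
suff -> : (x + y == 0) = (x == 0) && (y == 0) by rewrite negb_and.
apply/eqP/andP => [/M_con[-> ->] //|[/eqP-> /eqP->]]; exact: addr0.
Qed.

(** Sums in the semilattice are disjunctions, so a single nonzero parameter or occurring unknown
    makes the value true. *)
Lemma eval_nonzero t :
  eval (fun x : M => (x != 0) : or_bool) (fun=> true) t = false -> t = 0.
Proof.
case: t => m v /negbT/norP[/negPn/eqP /= -> sum0]; congr (_, _).
apply/ffunP=> i; rewrite ffunE; apply/eqP; move: sum0; apply: contraNT.
rewrite (bigD1 i) //=; case: (v i) => // n _.
by rewrite mulrS.
Qed.

(** In order, the hypotheses on the system make the degree well defined on B, make B conical, place
    the elements of degree 0 in M, make M cofinal, and embed M in B through [separation]. *)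
Lemma closed_solvable (d : 'I_k -> int) :
    strongly_unitarily_closed (torsion_free_cone P) M ->
    (forall s, s \in r -> degree d s.1.2 = degree d s.2.2) ->
    (forall s, s \in r -> s.1 <> 0 /\ s.2 <> 0) ->
    (forall v, degree d v = 0 -> exists m, entails (0, v) (m, 0)) ->
    (forall i, exists v, d i + degree d v = 0) ->
    (forall (N : nmodType) (g : {additive M -> N}),
       refinement N -> quasi_divisible N -> exists c, solution g c) ->
  exists c : 'I_k -> M, solution id c.
Proof.
move=> [[M_con M_tf] M_closed] r_deg r_nz deg0 cofinal local.
have [B [pi [pi_surj piE]]] : exists (B : nmodType)
    (pi : {additive linform -> B}),
    (forall b, exists t, pi t = b) /\ (forall s t, pi s = pi t <-> entails s t).
  apply: nmod_quotient => // [s t st|s t u st tu|s t u st] N g c N_tf sol.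
  - by rewrite st.
  - by rewrite st // tu.
  - by rewrite !(eval_is_nmod_morphism g c).2 st.
pose e (x : M) := pi (x, 0).
have e_morph : nmod_morphism e.
  split=> [|x y]; first exact: raddf0.
  by rewrite /e -raddfD; congr (pi (_, _)); rewrite addr0.
pose eA := additive_of e_morph.
pose c := pi \o unknown.
have solB : solution e c.
  move=> s rs; rewrite -!(morphism_eval pi); apply/piE => N g c' _; exact.
(* The degree is the evaluation in [int] that kills parameters and sends each unknown to its degree,
   which solves the system by homogeneity. *)
have entails_deg s t : entails s t -> degree d s.2 = degree d t.2.
  move=> /(_ int (\0 : {additive M -> int}) d torsion_free_int).
  by rewrite /eval !add0r; apply=> s' rs'; rewrite /eval !add0r; apply: r_deg.
pose nz := additive_of (nonzero_is_nmod_morphism M_con).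
pose ev := additive_of (eval_is_nmod_morphism nz (fun=> true)).
have entails_nz s t : entails s t -> ev s = ev t.
  apply; first exact: torsion_free_or_bool.
  have evT u : u <> 0 -> ev u = true.
    by move=> u_nz; apply: contra_notT u_nz => /negbTE/eval_nonzero.
  by move=> u /r_nz[u1 u2]; rewrite [LHS]evT // [RHS]evT.
have B_con : conical B.
  move=> b b'; have [s <-] := pi_surj b; have [t <-] := pi_surj b'.
  rewrite -raddfD -(raddf0 pi) => /piE/entails_nz.
  rewrite raddfD => st0.
  have /negbT/norP[/negbTE s0 /negbTE t0] : ev s || ev t = false := etrans st0 (raddf0 ev).
  by rewrite (eval_nonzero s0) (eval_nonzero t0).
have B_tf : torsion_free P B.
  move=> p Pp b b'; have [s <-] := pi_surj b; have [t <-] := pi_surj b'.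
  rewrite -!raddfMn => /piE st; apply/piE => N g c' N_tf sol.
  have := st N g c' N_tf sol.
  rewrite -![eval g c' _]/(additive_of (eval_is_nmod_morphism g c') _) !raddfMn.
  exact: N_tf.
have e_inj : injective e.
  move=> x y /piE xy; apply: contrapT => neq_xy.
  have [N [g [N_tf N_ref N_qd]]] := separation M_tf neq_xy; apply.
  have [c' sol] := local N g N_ref N_qd.
  have eval_param z : eval g c' (z, 0) = g z.
    by rewrite /eval big1 ?addr0 // => i _; rewrite ffunE mulr0n.
  by have := xy N g c' N_tf sol; rewrite !eval_param.
pose deg := additive_of (degree_is_nmod_morphism d).
have rangeE t : range e (pi t) <-> deg t.2 = 0.
  split=> [[x _ /piE/entails_deg deg_t]|/deg0[m /piE vm]].
    by rewrite /= -deg_t; apply: (degree_is_nmod_morphism d).1.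
  (* Split the form as (x, 0) + (0, v); its second summand is identified with the parameter [m]. *)
  case: t vm => x v vm; exists (x + m) => //.
  apply: etrans (raddfD eA x m) _.
  rewrite -[eA m]vm -[eA x]/(pi (x, 0)) -raddfD.
  by congr (pi (_, _)); rewrite ?addr0 ?add0r.
have sue : strong_unitary_extension (range eA).
  split.
  - split; first by exists 0 => //; exact: (raddf0 eA).
    by move=> _ _ [x _ <-] [y _ <-]; exists (x + y) => //; exact: (raddfD eA).
  - move=> b; have [t <-] := pi_surj b.
    pose bounded b := exists2 a, range eA a & alg_le b a.
    have bounded0 : bounded 0.
      by exists 0; exists 0; rewrite ?addr0 ?raddf0.
    have boundedD b1 b2 : bounded b1 -> bounded b2 -> bounded (b1 + b2).
      move=> [_ [x1 _ <-] le1] [_ [x2 _ <-] le2]; exists (eA (x1 + x2)).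
        by exists (x1 + x2).
      by rewrite raddfD; apply: alg_le_add.
    rewrite (morphism_eval pi t); apply: (boundedD (e t.1)).
      by exists (e t.1); [exists t.1|exists 0; rewrite addr0].
    elim/big_ind: _ => // i _.
    have [v div0] := cofinal i.
    have bounded_c : bounded (c i).
      (* Adding [v] to the unknown brings the degree to 0, so the sum lies in M and bounds the
         unknown. *)
      exists (pi (unknown i + (0, v))); last by rewrite raddfD; apply: alg_le_addr.
      apply/rangeE; rewrite raddfD -div0; congr (_ + _).
      rewrite /= /degree (bigD1 i) //= big1 => [|j ji].
        by rewrite ffunE eqxx addr0.
      by rewrite ffunE eq_sym (negbTE ji).
    by elim: (t.2 i) => // n IH; rewrite mulrS; apply: boundedD.
  - move=> _ _ b [x _ <-] [y _ <-]; have [t <-] := pi_surj b => xt_y.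
    apply/rangeE; move: xt_y; rewrite -[eA x]/(pi (x, 0)) -raddfD => /piE/entails_deg.
    rewrite -[LHS]/(deg (0 + t.2)) -[RHS]/(deg 0).
    by rewrite add0r raddf0.
  - move=> n b n_gt0; have [t <-] := pi_surj b; rewrite -raddfMn => /rangeE.
    rewrite (raddfMn snd) raddfMn => nt; apply/rangeE.
    by apply: (Num.Theory.pmulrnI n_gt0); rewrite nt mul0rn.
pose eqn (s : linform * linform) :=
  @Equation M k (fun i => s.1.2 i) (fun i => s.2.2 i) s.1.1 s.2.1.
have [|x sol_x] := M_closed (eqn @` [set` r]) (finite_image _ (finite_seq r)).
  exists B, eA; split=> //.
  (* Assignments are indexed by all naturals; indices from [k] on take the default 0 and do not
     occur in the equations. *)
  exists (fun n => oapp c 0 (insub n)) => _ [_ [s rs <-] <-].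
  rewrite /satisfies /= addrC [RHS]addrC; under eq_bigr do rewrite valK /=.
  by under [in RHS]eq_bigr do rewrite valK /=; apply: solB.
exists (fun i => x i) => s rs.
have : satisfies x (eqn s) by apply: sol_x; exists s.
by rewrite /satisfies /= addrC [RHS]addrC.
Qed.

End Systems.

(** * The systems for quasi-divisibility and refinement *)

Lemma closed_quasi_divisible (M : nmodType) :
  strongly_unitarily_closed (torsion_free_cone P) M -> quasi_divisible M.
Proof.
(* The case of 0 is set apart because [closed_solvable] asks for equations with nonzero sides. *)
move=> M_closed x; have [->|x_nz] := eqVneq x 0.
  by exists 0, 0; rewrite !mul0rn addr0.
pose v : {ffun 'I_2 -> nat} := [ffun i : 'I_2 => nth 0%N [:: 2; 3]%N i].
pose r : seq ((M * {ffun 'I_2 -> nat}) * (M * {ffun 'I_2 -> nat})) :=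
  [:: ((0, v), (x, 0))].
pose d (i : 'I_2) : int := nth 0 [:: 3; -2] i.
have degE w : degree d w = 3 * (w ord0)%:Z - 2 * (w (lift ord0 ord0))%:Z.
  rewrite /degree !big_ord_recl big_ord0 addr0 -!(mulr_natr (d _)) !natz.
  by rewrite mulNr.
have solE (N : nmodType) (g : {additive M -> N}) c :
    solution r g c <-> c ord0 *+ 2 + c (lift ord0 ord0) *+ 3 = g x.
  have evalE : (eval g c (0, v) = eval g c (x, 0)) <->
      c ord0 *+ 2 + c (lift ord0 ord0) *+ 3 = g x.
    by rewrite /eval !big_ord_recl !big_ord0 /= !ffunE /= raddf0 add0r !addr0.
  split=> [sol|eq_x s]; first by apply/evalE/(sol ((0, v), (x, 0)))/mem_head.
  by rewrite inE => /eqP ->; apply/evalE.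
have [|||||c] := @closed_solvable _ _ r d M_closed.
- by move=> s; rewrite inE => /eqP -> /=; rewrite !degE !ffunE.
- move=> s; rewrite inE => /eqP -> /=; split=> [[]|[/eqP]]; last exact/negP.
  by move/ffunP/(_ ord0); rewrite !ffunE.
- move=> w; rewrite degE => w0.
  (* Degree 0 means 3 w_0 = 2 w_1, so the form is [n] times 2u + 3v and equals [x *+ n]. *)
  have [n [w_0 w_1]] : exists n,
      w ord0 = (2 * n)%N /\ w (lift ord0 ord0) = (3 * n)%N.
    exists (w ord0 %/ 2)%N; lia.
  exists (x *+ n) => N g c _ /solE eq_x.
  rewrite /eval !big_ord_recl !big_ord0 /= !ffunE w_0 w_1 raddf0 raddfMn -eq_x.
  by rewrite add0r !addr0 mulrnDl -!mulrnA.
- case=> -[|[|//]] lt_i; first exists [ffun i : 'I_2 => nth 0%N [:: 1; 3]%N i].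
    by rewrite degE !ffunE.
  exists [ffun i : 'I_2 => nth 0%N [:: 2; 2]%N i]; by rewrite degE !ffunE.
- move=> N g _ /(_ (g x)) [u [w uw]]; exists (fun i => nth 0 [:: u; w] i).
  exact/solE.
by move/(solE _ idfun) => cx; exists (c ord0), (c (lift ord0 ord0)).
Qed.

Lemma closed_refinement (M : nmodType) :
  strongly_unitarily_closed (torsion_free_cone P) M -> refinement M.
Proof.
move=> M_closed a0 a1 b0 b1 eq_ab.
(* A zero summand gives an explicit refinement; afterwards all four equations have nonzero sides. *)
have [a0_0|/eqP a0_nz] := eqVneq a0 0.
  by exists 0, 0, b0, b1; rewrite a0_0 !add0r -eq_ab a0_0 add0r.
have [a1_0|/eqP a1_nz] := eqVneq a1 0.
  by exists b0, b1, 0, 0; rewrite a1_0 !addr0 -eq_ab a1_0 addr0.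
have [b0_0|/eqP b0_nz] := eqVneq b0 0.
  by exists 0, a0, 0, a1; rewrite b0_0 !add0r eq_ab b0_0 add0r.
have [b1_0|/eqP b1_nz] := eqVneq b1 0.
  by exists a0, 0, a1, 0; rewrite b1_0 !addr0 eq_ab b1_0 addr0.
pose i1 : 'I_4 := lift ord0 ord0; pose i2 : 'I_4 := lift ord0 (lift ord0 ord0).
pose i3 : 'I_4 := lift ord0 (lift ord0 (lift ord0 ord0)).
(* The unknowns are ordered c00, c01, c10, c11; omitted trailing coefficients are 0 by the default
   of [nth]. *)
pose vec (s : seq nat) : {ffun 'I_4 -> nat} := [ffun i : 'I_4 => nth 0%N s i].
pose r : seq ((M * {ffun 'I_4 -> nat}) * (M * {ffun 'I_4 -> nat})) :=
  [:: ((0, vec [:: 1; 1]%N), (a0, 0)); ((0, vec [:: 0; 0; 1; 1]%N), (a1, 0));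
      ((0, vec [:: 1; 0; 1]%N), (b0, 0)); ((0, vec [:: 0; 1; 0; 1]%N), (b1, 0))].
pose d (i : 'I_4) : int := nth 0 [:: 1; -1; -1; 1] i.
have degE w : degree d w = (w ord0)%:Z - (w i1)%:Z - (w i2)%:Z + (w i3)%:Z.
  rewrite /degree !big_ord_recl big_ord0 addr0 -!(mulr_natr (d _)) !natz.
  by rewrite !mulN1r !mul1r !addrA.
have eval_vec (N : nmodType) (g : {additive M -> N}) c w :
    eval g c (0, w) =
      c ord0 *+ w ord0 + c i1 *+ w i1 + c i2 *+ w i2 + c i3 *+ w i3.
  by rewrite /eval !big_ord_recl big_ord0 raddf0 add0r addr0 !addrA.
have eval_param (N : nmodType) (g : {additive M -> N}) (c : 'I_4 -> N) m :
    eval g c (m, 0) = g m.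
  by rewrite /eval big1 ?addr0 // => i _; rewrite ffunE mulr0n.
have solE (N : nmodType) (g : {additive M -> N}) c :
    solution r g c <-> [/\ g a0 = c ord0 + c i1, g a1 = c i2 + c i3,
                           g b0 = c ord0 + c i2 & g b1 = c i1 + c i3].
  split=> [sol|[a0E a1E b0E b1E] s].
    have sol_nth n := sol (nth ((0, 0), (0, 0)) r n).
    split; [have := sol_nth 0%N | have := sol_nth 1%N
           |have := sol_nth 2%N | have := sol_nth 3%N];
    rewrite mem_nth //= eval_vec eval_param !ffunE /=;
    by rewrite !mulr0n ?mulr1n ?add0r ?addr0 => <-.
  rewrite !inE => /or4P[]/eqP-> /=; rewrite eval_vec eval_param !ffunE /=;
  by rewrite ?a0E ?a1E ?b0E ?b1E !mulr0n ?mulr1n ?add0r ?addr0.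
have vec_nz s i : (i < 4)%N -> nth 0%N s i = 1%N -> (0 : M, vec s) <> 0.
  move=> lt_i si [/ffunP/(_ (Ordinal lt_i))]; by rewrite !ffunE /= si.
have param_nz m : m <> 0 -> (m, 0 : {ffun 'I_4 -> nat}) <> 0.
  by move=> m_nz [].
have [|||||c] := @closed_solvable _ _ r d M_closed.
- by move=> s; rewrite !inE => /or4P[]/eqP-> /=; rewrite !degE !ffunE.
- move=> s; rewrite !inE => /or4P[]/eqP-> /=; split; try exact: param_nz.
  + exact: (@vec_nz _ 0%N).
  + exact: (@vec_nz _ 2%N).
  + exact: (@vec_nz _ 0%N).
  + exact: (@vec_nz _ 1%N).
- move=> w; rewrite degE => w0.
  (* A form with w_0 + w_3 = w_1 + w_2 is a sum of rows and columns of the refinement matrix: [j],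
     [k], [l], [m] count the copies of [a0], [b0], [b1], [a1]. Taking [j] as large as possible keeps
     the others nonnegative. *)
  have [j [k [l [m [w_0 w_1 w_2 w_3]]]]] : exists j k l m,
      [/\ w ord0 = (j + k)%N, w i1 = (j + l)%N,
          w i2 = (k + m)%N & w i3 = (l + m)%N].
    pose j := minn (w ord0) (w i1).
    exists j, (w ord0 - j)%N, (w i1 - j)%N, (w i3 - (w i1 - j))%N.
    by rewrite /j; split; lia.
  exists (a0 *+ j + b0 *+ k + b1 *+ l + a1 *+ m) => N g c _ /solE[a0E a1E b0E b1E].
  rewrite eval_vec eval_param w_0 w_1 w_2 w_3 !raddfD !raddfMn a0E a1E b0E b1E.
  rewrite !mulrnDl ?mulrnDr !addrA.
  by rewrite [RHS](ACl (1*3*2*5*4*7*6*8)).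
(* Unknowns of degree 1 are compensated by c01, those of degree -1 by c00. *)
- have degD i w : degree d w = - d i -> exists v, d i + degree d v = 0.
    by move=> dw; exists w; rewrite dw subrr.
  case=> -[|[|[|[|//]]]] lt_i.
  + by apply: (degD _ (vec [:: 0; 1]%N)); rewrite degE !ffunE.
  + by apply: (degD _ (vec [:: 1]%N)); rewrite degE !ffunE.
  + by apply: (degD _ (vec [:: 1]%N)); rewrite degE !ffunE.
  + by apply: (degD _ (vec [:: 0; 1]%N)); rewrite degE !ffunE.
- move=> N g N_ref _.
  have [c00 [c01 [c10 [c11 c_ref]]]] : exists c00 c01 c10 c11 : N,
      [/\ g a0 = c00 + c01, g a1 = c10 + c11,
          g b0 = c00 + c10 & g b1 = c01 + c11].
    by apply: N_ref; rewrite -!raddfD eq_ab.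
  by exists (fun i => nth 0 [:: c00; c01; c10; c11] i); apply/solE.
by move/(solE _ idfun) => c_ref; exists (c ord0), (c i1), (c i2), (c i3).
Qed.

End TorsionFree.

(** * Quasi-divisibility and refinement combined *)

Theorem theorem3p5 (P : set nat) (P_semigroup : subsemigroup_of_positives P)
    (P_not_sub1 : ~ (P `<=` [set 1%N])) (M : nmodType)
    (M_closed : strongly_unitarily_closed (torsion_free_cone P) M) :
  quasi_divisible M /\ refinement_cone M.
Proof.
have [p0 P_p0 p0_gt1] : exists2 p0, P p0 & (1 < p0)%N.
  apply: contrapT => no_p0; apply: P_not_sub1 => p P_p /=.
  have p_gt0 := P_semigroup.1 _ P_p; apply: contrapT => p_neq1.
  by apply: no_p0; exists p => //; lia.
split; first exact: closed_quasi_divisible P_p0 p0_gt1 _ M_closed.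
by split; [case: M_closed => -[] | exact: closed_refinement P_p0 p0_gt1 _ M_closed].
Qed.
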